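(* Let $\boldsymbol{S}$ denote a randomly chosen holdout set of size $n$ (a random element of $\mathcal{X}^n$). Let $\mathcal{A}$ be an algorithm that is given access to $\mathrm{SparseValidate}(m,B)$ (run on holdout set $\boldsymbol{S}$) and outputs queries $\psi_1,\ldots,\psi_m$ such that each $\psi_i$ is in some set $\Psi_i$ of functions from $\mathcal{X}^n$ to $\{0,1\}$. Assume that for every $i\in[m]$ and $\psi_i\in\Psi_i$, $\Pr[\psi_i(\boldsymbol{S})=1]\le\beta_i$. Let $\boldsymbol{\psi}_i$ be the random variable equal to the $i$-th query of $\mathcal{A}$ on $\boldsymbol{S}$. Then $$\Pr[\boldsymbol{\psi}_i(\boldsymbol{S})=1]\le\ell_i\cdot\beta_i,\qquad\text{where}\quad \ell_i=\sum_{j=0}^{\min\{i-1,B\}}\binom{i-1}{j}\le m^B.$$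
   Context: $\mathrm{SparseValidate}(m,B)$ is the following interactive algorithm, holding a holdout set $S_h\in\mathcal{X}^n$: it accepts adaptively chosen queries, each a Boolean function $\psi:\mathcal{X}^n\to\{0,1\}$, and answers with $\psi(S_h)$. It has a budget $m$ for the total number of queries that can be asked and a budget $B$ for the number of queries whose answer was $1$; once either budget is exhausted, no additional answers are given. The algorithm $\mathcal{A}$ (possibly randomized, with randomness independent of $\boldsymbol{S}$) accesses the holdout set only through the answers of SparseValidate. $[m]=\{1,\ldots,m\}$. *)

(* Defs.v *)
From HB Require Import structures.
From mathcomp Require Import all_boot all_order all_algebra.
From mathcomp Require Import all_classical all_reals all_analysis.

Set Implicit Arguments.
Unset Strict Implicit.
Unset Printing Implicit Defensive.

Import Order.TTheory GRing.Theory Num.Theory.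

Local Open Scope classical_set_scope.
Local Open Scope ring_scope.

(* Boolean functions on X^n; they are measurable (for the product
   sigma-algebra on X^n), so that Pr[psi(S) = 1] is meaningful. *)
Notation query n X := {mfun n.-tuple X >-> bool}.

Section SparseValidate.
Context (dX : measure_display) (X : measurableType dX) (n : nat).
Variables (m B : nat).

(* [h] lists the responses to the earlier queries, in order: [Some b] is the
   answer [b], and [None] records that no answer was given. *)
Definition sparse_validate (s : n.-tuple X) (h : seq (option bool))
    (psi : query n X) : option bool :=
  if (size h < m)%N && (count_mem (Some true) h < B)%N
  then Some (psi s) else None.

(* A deterministic analyst: the next query as a function of the responses
   received so far; this is its only access to the holdout set. *)
Definition analyst := seq (option bool) -> query n X.

Fixpoint responses (A : analyst) (s : n.-tuple X) (k : nat) :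
    seq (option bool) :=
  if k is k'.+1 then
    let h := responses A s k' in rcons h (sparse_validate s h (A h))
  else [::].

(* The [i]-th query (i >= 1) asked by [A] when the holdout set is [s]. *)
Definition nth_query (A : analyst) (s : n.-tuple X) (i : nat) : query n X :=
  A (responses A s i.-1).

End SparseValidate.

Definition independent_RV (d d1 d2 : measure_display) (Omega : measurableType d)
    (T1 : measurableType d1) (T2 : measurableType d2) (R : realType)
    (P : probability Omega R) (Y : {RV P >-> T1}) (Z : {RV P >-> T2}) : Prop :=
  forall (U : set T1) (V : set T2), measurable U -> measurable V ->
    P (Y @^-1` U `&` Z @^-1` V) = (P (Y @^-1` U) * P (Z @^-1` V))%E.

(* A randomized analyst is a family of deterministic ones indexed by its random
   string. Joint measurability makes its queries random variables; it is
   automatic when the random strings form a countable discrete space. *)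
Definition measurable_analyst (dX dW : measure_display) (X : measurableType dX)
    (n : nat) (W : measurableType dW) (A : W -> analyst X n) : Prop :=
  forall h : seq (option bool),
    measurable_fun [set: W * n.-tuple X] (fun p => A p.1 h p.2).

Definition ell (B i : nat) : nat :=
  (\sum_(0 <= j < (minn i.-1 B).+1) 'C(i.-1, j))%N.

(* Main.v *)
(* A query depends on the holdout set only through the earlier responses, and
   these take at most [ell B i] values: once [B] answers were [true] all later
   responses are [None]. A union bound over these histories leaves, for each of
   them, a query fixed by the random string and so independent of the holdout
   set, hence answered [true] with probability at most [beta i]. *)
Require Import Defs.
From HB Require Import structures.
From mathcomp Require Import all_boot all_order all_algebra.
From mathcomp Require Import all_classical all_reals all_analysis.
From mathcomp Require Import measurable_realfun.

Set Implicit Arguments.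
Unset Strict Implicit.
Unset Printing Implicit Defensive.

Import Order.TTheory GRing.Theory Num.Theory.

Local Open Scope classical_set_scope.
Local Open Scope ring_scope.

Lemma probability_seq_union_le (R : realType) (d : measure_display)
    (Omega : measurableType d) (P : probability Omega R) (I : eqType)
    (s : seq I) (E : I -> set Omega) (c : R) :
  (forall x, x \in s -> measurable (E x)) ->
  (forall x, x \in s -> (P (E x) <= c%:E)%E) ->
  (P (\bigcup_(x in [set` s]) E x) <= ((size s)%:R * c)%:E)%E.
Proof.
elim: s => [|a s IHs] mE leE.
  by rewrite set_nil bigcup_set0 measure0 mul0r.
have mEs x : x \in s -> measurable (E x).
  by move=> xs; apply: mE; rewrite inE xs orbT.
rewrite (_ : \bigcup_(x in _) _ = E a `|` \bigcup_(x in [set` s]) E x); last first.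
  by rewrite -bigcup_setU1; apply: eq_bigcupl; split=> x /=; rewrite inE;
    [case/orP=> [/eqP|]; [left|right] | case=> [->|->]; rewrite ?eqxx ?orbT].
have mU : measurable (\bigcup_(x in [set` s]) E x).
  by apply: fin_bigcup_measurable => // x /mEs.
have mEa : measurable (E a) by apply: mE; rewrite inE eqxx.
apply: (le_trans (measureU2 P mEa mU)).
rewrite /= -nat1r mulrDl mul1r EFinD.
apply: leeD; first by apply: leE; rewrite inE eqxx.
by apply: IHs => // x xs; apply: leE; rewrite inE xs orbT.
Qed.

(** Independence says that the joint law agrees with the product measure on rectangles, which
    determine the product measure. [Z] comes first so that sections of [D] are taken at a fixed
    value of [Z]. *)
Lemma independent_RV_product (d d1 d2 : measure_display)
    (Omega : measurableType d) (T1 : measurableType d1) (T2 : measurableType d2)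
    (R : realType) (P : probability Omega R)
    (Y : {RV P >-> T1}) (Z : {RV P >-> T2}) (D : set (T2 * T1)) :
  independent_RV Y Z -> measurable D ->
  P [set w | D (Z w, Y w)] = (distribution P Z \x distribution P Y)%E D.
Proof.
move=> indep mD.
pose ZY w := (Z w, Y w).
have mZY : measurable_fun setT ZY by apply: measurable_fun_pair.
pose ZYf : {mfun Omega >-> (T2 * T1)%type} :=
  HB.pack ZY (isMeasurableFun.Build _ _ _ _ _ mZY).
rewrite (@product_measure_unique _ _ _ _ _ _ _ (distribution P ZYf)) //.
move=> U V mU mV; rewrite /distribution /pushforward muleC -indep //.
by congr (P _); rewrite predeqE => w /=; split=> -[].
Qed.

(* Being in [E] only certifies the bound for the realised value of [Z], so the
   values of [Z] whose section is too large are cut out of [D] beforehand. *)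
Lemma independent_RV_section_bound (d d1 d2 : measure_display)
    (Omega : measurableType d) (T1 : measurableType d1) (T2 : measurableType d2)
    (R : realType) (P : probability Omega R)
    (Y : {RV P >-> T1}) (Z : {RV P >-> T2}) (D : set (T2 * T1))
    (E : set Omega) (c : R) :
  independent_RV Y Z -> measurable D -> measurable E -> 0 <= c ->
  (forall w, E w -> D (Z w, Y w)) ->
  (forall w, E w -> (P [set w' | D (Z w, Y w')] <= c%:E)%E) ->
  (P E <= c%:E)%E.
Proof.
move=> indep mD mE c0 ED Ec.
pose g (r : T2) : \bar R := distribution P Y (xsection D r).
have gE r : g r = P [set w' | D (r, Y w')].
  rewrite /g /distribution /pushforward; congr (P _).
  by rewrite predeqE => w /=; rewrite /xsection /= in_setE.
have mg : measurable_fun setT g by exact: measurable_fun_xsection.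
pose D' := D `&` (fst @^-1` (g @^-1` [set x | (x <= c%:E)%E])).
have mD' : measurable D'.
  apply: measurableI => //.
  rewrite -[X in measurable X]setTI.
  apply: measurable_fst => //.
  by rewrite -[X in measurable X]setTI; exact: emeasurable_fun_infty_c.
apply: (@le_trans _ _ (P [set w | D' (Z w, Y w)])).
  apply: le_measure; rewrite ?inE //.
    rewrite -[X in measurable X]setTI.
    by apply: (measurable_fun_pair (measurable_funPT Z) (measurable_funPT Y)).
  by move=> w Ew; split=> /=; [exact: ED | rewrite gE; exact: Ec].
rewrite independent_RV_product // /product_measure1.
apply: (@le_trans _ _ (\int[distribution P Z]_x (cst c%:E x))%E).
  apply: ge0_le_integral => //=.
    exact: measurable_fun_xsection.
  move=> r _.
  (* Either [r] was kept and the section of [D'] lies in that of [D], or it was cut out and the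
     section is empty. *)
  have [gr|gr] := leP (g r) c%:E.
    apply: le_trans gr; apply: le_measure; rewrite ?inE;
      try exact: measurable_xsection.
    by move=> y; rewrite /xsection /= !in_setE => -[].
  rewrite (_ : xsection D' r = set0) ?measure0 ?lee_fin //.
  rewrite -subset0 => y; rewrite /xsection /= in_setE => -[_ /=].
  by rewrite leNgt gr.
by rewrite integral_cst // [X in (_ * X)%E]probability_setT mule1.
Qed.

(* Head first, with [b] the remaining budget of answers [true]; the bound [m] on
   the number of queries is ignored, so this is only meant for [k <= m]. *)
Fixpoint histories (b k : nat) : seq (seq (option bool)) :=
  if k is k'.+1 then
    if b is b'.+1 then
      map (cons (Some true)) (histories b' k')
        ++ map (cons (Some false)) (histories b k')
    else map (cons None) (histories 0 k')
  else [:: [::]].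

Arguments histories : simpl never.

Lemma histories_nil (b : nat) : histories b 0 = [:: [::]].
Proof. by []. Qed.

Lemma histories_exhausted (k : nat) :
  histories 0 k.+1 = map (cons None) (histories 0 k).
Proof. by []. Qed.

Lemma historiesSS (b k : nat) :
  histories b.+1 k.+1 =
    map (cons (Some true)) (histories b k)
      ++ map (cons (Some false)) (histories b.+1 k).
Proof. by []. Qed.

(** Responses are appended at the end while [histories] grows at the head. Peeling off a leading
    [Some true] lowers the budget and the count together, so the induction runs over all [b]. *)
Lemma histories_rcons_some (b k : nat) (h : seq (option bool)) (x : bool) :
  h \in histories b k -> (count_mem (Some true) h < b)%N ->
  rcons h (Some x) \in histories b k.+1.
Proof.
elim: k b h => [|k IHk] [|b] h //.
  by rewrite inE historiesSS => /eqP-> _; case: x.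
rewrite !historiesSS !mem_cat => /orP[] /mapP[h' h'in ->] hb; apply/orP.
  by left; rewrite rcons_cons map_f //; apply: IHk.
by right; rewrite rcons_cons -historiesSS map_f //; apply: IHk.
Qed.

Lemma histories_rcons_none (b k : nat) (h : seq (option bool)) :
  h \in histories b k -> (b <= count_mem (Some true) h)%N ->
  rcons h None \in histories b k.+1.
Proof.
elim: k b h => [|k IHk] [|b] h.
- by rewrite inE => /eqP->.
- by rewrite inE => /eqP->.
- rewrite histories_exhausted => /mapP[h' h'in ->] _.
  by rewrite histories_exhausted rcons_cons map_f //; apply: IHk.
rewrite !historiesSS !mem_cat => /orP[] /mapP[h' h'in ->] hb; apply/orP.
  by left; rewrite rcons_cons map_f //; apply: IHk.
by right; rewrite rcons_cons -historiesSS map_f //; apply: IHk.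
Qed.

Lemma size_responses (dX : measure_display) (X : measurableType dX)
    (n m B : nat) (A : analyst X n) (s : n.-tuple X) (k : nat) :
  size (responses m B A s k) = k.
Proof. by elim: k => //= k IHk; rewrite size_rcons IHk. Qed.

(** For [k <= m] the query budget never intervenes, so [None] arises only when [B] answers were
    [true]. *)
Lemma responses_histories (dX : measure_display) (X : measurableType dX)
    (n m B : nat) (A : analyst X n) (s : n.-tuple X) (k : nat) :
  (k <= m)%N -> responses m B A s k \in histories B k.
Proof.
elim: k => [|k IHk] km; first by rewrite inE.
rewrite [responses _ _ _ _ _]/= /sparse_validate size_responses km.
case: ltnP => /= hB.
  by apply: histories_rcons_some => //; apply: IHk; exact: ltnW.
by apply: histories_rcons_none => //; apply: IHk; exact: ltnW.
Qed.

(** A history is determined by the positions of its at most [b] answers [true]; splitting on the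
    first response is Pascal's rule summed over [j]. *)
Lemma size_histories (b k : nat) :
  size (histories b k) = (\sum_(0 <= j < b.+1) 'C(k, j))%N.
Proof.
elim: k b => [|k IHk] b.
  by rewrite big_nat_recl //= bin0 big1_seq.
case: b => [|b].
  by rewrite histories_exhausted size_map IHk !big_nat1 !bin0.
(* The terms [j = 0] are split off so that [binS] matches the remaining, shifted ones. *)
rewrite historiesSS size_cat !size_map !IHk [RHS]big_nat_recl //.
rewrite [X in (_ + X)%N = _]big_nat_recl // !bin0.
rewrite addnCA -big_split; congr addn.
by apply: eq_bigr => j _; rewrite binS addnC.
Qed.

(** The cut-off at [i.-1] changes nothing, as the binomials beyond it vanish. *)
Lemma size_histories_ell (B i : nat) : size (histories B i.-1) = ell B i.
Proof.
rewrite size_histories /ell.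
have le_min : ((minn i.-1 B).+1 <= B.+1)%N by rewrite ltnS geq_minr.
rewrite (big_cat_nat (leq0n _) le_min) /= [X in (_ + X)%N]big1_seq ?addn0 // => j /=.
rewrite mem_index_iota => /andP[lo hi]; apply: bin_small.
move: lo; rewrite gtn_min; case/orP => // Bj.
by move: hi; rewrite ltnS leqNgt Bj.
Qed.

(** With [k = i.-1] the bound reads [i ^ B], which is at most [m ^ B]. *)
Lemma size_histories_le (b k : nat) : (size (histories b k) <= k.+1 ^ b)%N.
Proof.
elim: k b => [|k IHk] [|b].
- by [].
- by rewrite histories_nil exp1n.
- by rewrite histories_exhausted size_map; exact: (IHk 0).
rewrite historiesSS size_cat !size_map.
apply: (leq_trans (leq_add (IHk b) (IHk b.+1))).
(* The sum is [(k+2) * (k+1)^b], which leaves [(k+1)^b <= (k+2)^b]. *)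
rewrite expnS -mulSn expnS leq_mul2l /=.
by case: b => // b; rewrite leq_exp2r.
Qed.

Lemma measurable_query_preimage (dX dW : measure_display) (X : measurableType dX)
    (n : nat) (W : measurableType dW) (A : W -> analyst X n)
    (h : seq (option bool)) (b : bool) :
  measurable_analyst A ->
  measurable [set p : W * n.-tuple X | A p.1 h p.2 = b].
Proof.
by move=> mA; rewrite -[X in measurable X]setTI; apply: (mA h _ [set b]).
Qed.

Lemma measurable_responses (dX dW : measure_display) (X : measurableType dX)
    (n m B : nat) (W : measurableType dW) (A : W -> analyst X n)
    (k : nat) (h : seq (option bool)) :
  measurable_analyst A ->
  measurable [set p : W * n.-tuple X | responses m B (A p.1) p.2 k = h].
Proof.
have mcst (Q : Prop) : measurable [set _ : W * n.-tuple X | Q].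
  have [q|nq] := pselect Q; first by rewrite (_ : mkset _ = setT) // predeqE.
  by rewrite (_ : mkset _ = set0) // -subset0.
move=> mA; elim: k h => [|k IHk] h; first exact: (mcst ([::] = h)).
case/lastP: h => [|h x].
  rewrite (_ : [set _ | _] = set0) // -subset0 => p /= /(congr1 size).
  by rewrite size_rcons.
(* Once the earlier responses are fixed to be [h], the next query is [A p.1 h], to which joint
   measurability applies. *)
rewrite (_ : [set _ | _] = [set p | responses m B (A p.1) p.2 k = h] `&`
    [set p | sparse_validate m B p.2 h (A p.1 h) = x]); last first.
  rewrite predeqE => p /=; split; last by move=> [-> ->].
  by move=> /rcons_inj[eh <-]; rewrite eh.
apply: measurableI => //.
(* Whether an answer is given depends on [h] alone. *)
rewrite /sparse_validate; case: (_ && _); last exact: (mcst (None = x)).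
case: x => [b|]; last by rewrite (_ : [set _ | _] = set0) // -subset0.
rewrite (_ : [set _ | _] = [set p | A p.1 h p.2 = b]).
  exact: measurable_query_preimage.
by rewrite predeqE => p /=; split=> [[]|->].
Qed.

Theorem theorem27 (R : realType)
  (dO dX dW : measure_display)
  (Omega : measurableType dO) (X : measurableType dX) (W : measurableType dW)
  (P : probability Omega R)
  (n m B : nat)
  (S : {RV P >-> n.-tuple X})
  (rho : {RV P >-> W})
  (indep : independent_RV S rho)
  (A : W -> analyst X n)
  (measA : measurable_analyst A)
  (Psi : nat -> set (query n X))
  (beta : nat -> R)
  (A_in_Psi : forall (i : nat) (w : Omega), (1 <= i <= m)%N ->
     Psi i (nth_query m B (A (rho w)) (S w) i))
  (Psi_beta : forall (i : nat) (psi : query n X), (1 <= i <= m)%N ->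
     Psi i psi -> (P [set w | psi (S w) = true] <= (beta i)%:E)%E)
  (i : nat) (hi : (1 <= i <= m)%N) :
  (P [set w | nth_query m B (A (rho w)) (S w) i (S w) = true]
     <= ((ell B i)%:R * beta i)%:E)%E
  /\ (ell B i <= m ^ B)%N.
Proof.
set k := i.-1; have km : (k < m)%N by case/andP: hi; rewrite /k; case: (i).
split; last first.
  rewrite -size_histories_ell; apply: leq_trans (size_histories_le _ _) _.
  by case: (B) => // b; rewrite leq_exp2r.
(* [Psi_beta] yields a sign only if [Psi i] has an element; the query asked at some outcome [w]
   provides one. *)
have beta0 : 0 <= beta i.
  have [w _] : [set: Omega] !=set0.
    apply/set0P/eqP => Omega0; have := @probability_setT _ _ _ P.
    by rewrite Omega0 measure0 => /eqP; rewrite eq_sym onee_eq0.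
  rewrite -lee_fin; apply: le_trans (Psi_beta _ _ hi (A_in_Psi i w hi)).
  exact: measure_ge0.
(* In the second condition the query depends on [w] through [rho w] only, since [h] is fixed. *)
pose E h := [set w | responses m B (A (rho w)) (S w) k = h /\
                     A (rho w) h (S w) = true].
have mE h : measurable (E h).
  rewrite (_ : E h = (fun w => (rho w, S w)) @^-1`
    ([set p | responses m B (A p.1) p.2 k = h] `&`
     [set p | A p.1 h p.2 = true])) //.
  rewrite -[X in measurable X]setTI.
  apply: (measurable_fun_pair (measurable_funPT rho) (measurable_funPT S)) => //.
  by apply: measurableI;
    [exact: measurable_responses | exact: measurable_query_preimage].
rewrite (_ : [set _ | _] = \bigcup_(h in [set` histories B k]) E h); last first.
  rewrite predeqE => w; split => [/= Aw|[h _ [/= <-]] //].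
  exists (responses m B (A (rho w)) (S w) k) => //=.
  by apply: responses_histories; exact: ltnW.
rewrite -size_histories_ell; apply: probability_seq_union_le => // h _.
apply: (independent_RV_section_bound indep
  (measurable_query_preimage h true measA)) => //.
  by move=> w [].
(* [A_in_Psi] covers only queries actually asked; on [E h] the history [h] is realised, so
   [A (rho w) h] is one of them. *)
move=> w [hw _]; apply: (Psi_beta _ (A (rho w) h) hi).
by rewrite -hw; exact: A_in_Psi.
Qed.
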